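(* For every integer $k \ge 3$, there is a deterministic one-way number-on-the-forehead protocol for $\widehat{\textsc{mpj}}^{\rm perm}_k$ of communication cost $O(n \log^{(k-1)}n)$ in which every player is collapsing.
   Context: Logarithms are base $2$ and $\log^{(m)}n$ denotes the $m$-times iterated logarithm of $n$; $[n]=\{1,\dots,n\}$. $\widehat{\textsc{mpj}}_k:[n]\times([n]^{[n]})^{k-1}\to[n]$ is given by $\widehat{\textsc{mpj}}_k(i,f_2,\ldots,f_k) = f_k\circ\cdots\circ f_2(i)$, and $\widehat{\textsc{mpj}}^{\rm perm}_k$ is its restriction to inputs in which $f_2,\dots,f_k$ are all permutations of $[n]$. Write the input as $(z_1,\dots,z_k)$ with $z_1=i$, $z_j=f_j$ for $j\ge2$. In the number-on-the-forehead model $z_j$ is on player $j$'s forehead and she sees all $z_h$, $h\ne j$. In a deterministic one-way protocol, players $1,\dots,k$ each write exactly one message on a public blackboard in this order, each message a deterministic function of what the player sees and earlier messages; player $k$'s message must equal the function value. Cost is the total number of bits written in the worst case. Player $j$ is collapsing if her message depends only on the previous messages, on $z_1,\dots,z_{j-1}$, and on the function $g_j(w_1,\dots,w_j)=\widehat{\textsc{mpj}}_k(w_1,\dots,w_j,z_{j+1},\dots,z_k)$; concretely, only on the previous messages, $i,f_2,\dots,f_{j-1}$ and the composition $f_k\circ\cdots\circ f_{j+1}$ (player $k$ sees only $i,f_2,\dots,f_{k-1}$ and the messages). *)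

(* Defs.v *)
From mathcomp Require Import all_boot all_order all_algebra all_fingroup.
From mathcomp Require Import all_classical all_reals all_analysis.
Import numFieldNormedType.Exports.

Set Implicit Arguments.
Unset Strict Implicit.
Unset Printing Implicit Defensive.

(* Conventions.  [n] is 'I_n.  Players and input coordinates are numbered
   1, ..., k, by natural numbers.  The k-1 functions f_2, ..., f_k are indexed
   by l : 'I_k.-1, the index l standing for f_(l+2), so that the coordinate
   z_(l+2) is the function of index l and z_1 is the starting point.          *)

Definition mpj (k n : nat) (i : 'I_n) (f : 'I_k.-1 -> 'I_n -> 'I_n) : 'I_n :=
  foldl (fun x l => f l x) i (enum 'I_k.-1).

Definition perm_input (k n : nat) : finType :=
  ('I_n * {ffun 'I_k.-1 -> {perm 'I_n}})%type.

Definition mpj_perm (k n : nat) (z : perm_input k n) : 'I_n :=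
  mpj z.1 (fun l x => z.2 l x).

Definition agree_on (k n : nat) (S : pred nat) (z z' : perm_input k n) : Prop :=
  (S 1 -> z.1 = z'.1) /\ (forall l : 'I_k.-1, S l.+2 -> z.2 l = z'.2 l).

(* The input (w_1, ..., w_j, z_(j+1), ..., z_k). *)
Definition splice (k n j : nat) (w z : perm_input k n) : perm_input k n :=
  (if 1 <= j then w.1 else z.1,
   [ffun l : 'I_k.-1 => if l.+2 <= j then w.2 l else z.2 l]).

Definition bits := seq bool.

(* [message j z t] is the message of player j on input z when the earlier
   messages are t.                                                            *)
Record nof_protocol (k n : nat) := NofProtocol {
  message :> nat -> perm_input k n -> seq bits -> bits;
  message_nof : forall (j : nat) (z z' : perm_input k n) (t : seq bits),
    1 <= j <= k -> agree_on (fun h => h != j) z z' ->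
    message j z t = message j z' t
}.

(* The messages of players 1, ..., j, in this order. *)
Fixpoint board (k n : nat) (P : nof_protocol k n) (z : perm_input k n)
    (j : nat) : seq bits :=
  if j is j'.+1 then
    let t := board P z j' in rcons t (P j z t)
  else [::].

Definition sent (k n : nat) (P : nof_protocol k n) (j : nat)
    (z : perm_input k n) : bits :=
  P j z (board P z j.-1).

(* The length of a message may depend on the input, but the end of a message
   has to be recognizable from the bits on the blackboard: otherwise message
   boundaries would convey information that the cost does not count.          *)
Definition self_delimiting (k n : nat) (P : nof_protocol k n) : Prop :=
  forall (j : nat) (z z' : perm_input k n), 1 <= j <= k ->
    board P z j.-1 = board P z' j.-1 ->
    prefix (sent P j z) (sent P j z') -> sent P j z = sent P j z'.

(* An element of [n] as a word of ceil(log2 n) bits. *)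
Definition encode (n : nat) (x : 'I_n) : bits :=
  mkseq (fun b => odd (x %/ 2 ^ b)) (up_log 2 n).

Definition computes_mpj_perm (k n : nat) (P : nof_protocol k n) : Prop :=
  forall z : perm_input k n, sent P k z = encode (mpj_perm z).

Definition cost (k n : nat) (P : nof_protocol k n) : nat :=
  \max_(z : perm_input k n) \sum_(m <- board P z k) size m.

(* The message of player j is a function of the earlier messages, of
   z_1, ..., z_(j-1), and of the function g_j.                                *)
Definition collapsing (k n : nat) (P : nof_protocol k n) (j : nat) : Prop :=
  forall (z z' : perm_input k n) (t : seq bits),
    agree_on (fun h => h < j) z z' ->
    (forall w : perm_input k n,
       mpj_perm (splice j w z) = mpj_perm (splice j w z')) ->
    P j z t = P j z' t.

Local Open Scope ring_scope.

Definition log2 (R : realType) (x : R) : R := ln x / ln 2%:R.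

Definition iterated_log (R : realType) (m : nat) (x : R) : R :=
  iter m (@log2 R) x.

(* Main.v *)
Require Import Defs.
From mathcomp Require Import all_boot all_order all_algebra all_fingroup.
From mathcomp Require Import all_classical all_reals all_analysis.
From mathcomp Require Import zify ring lra.
Import numFieldNormedType.Exports.
Import Order.TTheory GRing.Theory Num.Theory.

Set Implicit Arguments.
Unset Strict Implicit.

(* Write F_j for f_k o ... o f_(j+1) and x_j for f_j o ... o f_2 (i), so that
   F_j x_j is the answer for every j.  Let d_0 = 0 and let d_j be the (k - j)-fold
   iterated logarithm of n for j > 0, so that d_(k-1) = log n and, for j > 1,
   d_(j-1) = log d_j.  The invariant is
   that the first j - 1 messages determine, for whoever knows x_(j-1), the d_(j-1)
   leading bits of the answer.  Player j < k, who knows x_(j-1), lists the d_j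
   leading bits of F_j x for those x at which F_j x has these d_(j-1) leading
   bits, and marks the other x by one bit.  Since F_j is injective, at most
   2^(log n - d_(j-1)) = n / d_j points x are listed, so the message costs O(n)
   when j > 1, while the first message costs O(n log^(k-1) n).  Player k, who
   knows x_(k-1), reads off the whole answer. *)

(** * Tables of optional words of a common width *)

Definition table (s : seq (option bits)) : bits :=
  flatten [seq (if o is Some b then true :: b else [:: false]) | o <- s].

Definition entry_width (d : nat) (o : option bits) : bool :=
  if o is Some b then size b == d else true.

(** Entries carry a flag but no length, so the reader must supply the width [d] to skip the earlier
    ones. *)
Fixpoint lookup (d x : nat) (m : bits) : bits :=
  if x is x'.+1 then
    lookup d x' (if head false m then drop d.+1 m else behead m)
  else take d (behead m).

(** Keeps the message of player 1 independent of the starting point, which is on her own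
    forehead. *)
Lemma lookup0 x m : lookup 0 x m = [::].
Proof. by elim: x m => [|x IH] m /=; rewrite ?take0 ?IH. Qed.

Lemma lookup_table d s x b :
  all (entry_width d) s -> nth None s x = Some b -> lookup d x (table s) = b.
Proof.
elim: s x => [|o s IH] [|x] //=.
  by case: o => [c|] //= /andP[/eqP <- _] [<-]; rewrite take_size_cat.
case: o => [c|] /=; last exact: IH.
by case/andP=> /eqP sc ws; rewrite drop_size_cat //; exact: IH.
Qed.

Lemma prefix_cat_inj (T : eqType) (a b s t : seq T) :
  size a = size b -> prefix (a ++ s) (b ++ t) -> a = b /\ prefix s t.
Proof.
elim: a b => [|x a IH] [|y b] //= [sab].
by case/andP=> /eqP -> /(IH _ sab)[-> ?].
Qed.

(** Each flag fixes the length of its entry, so the two tables are parsed in step and, having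
    equally many entries, end together. *)
Lemma table_prefix_free d s t :
  all (entry_width d) s -> all (entry_width d) t -> size s = size t ->
  prefix (table s) (table t) -> table s = table t.
Proof.
elim: s t => [|o s IH] [|p t] //= /andP[wo ws] /andP[wp wt] [st].
have := IH _ ws wt st; rewrite /table /=; case: o wo => [a|]; case: p wp => [b|] //=.
  move=> wb wa IHst /prefix_cat_inj[|-> /IHst -> //].
  by rewrite (eqP wa) (eqP wb).
by move=> _ _ IHst /IHst ->.
Qed.

Lemma size_table d s : all (entry_width d) s ->
  size (table s) = size s + count isSome s * d.
Proof.
elim: s => //= o s IH /andP[wo /IH]; rewrite /table size_cat => ->.
by case: o wo => [b /eqP /= ->|_ /=]; lia.
Qed.

(** * Binary words and leading bits *)

Definition word (d x : nat) : bits := mkseq (fun b => odd (x %/ 2 ^ b)) d.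

Lemma wordS d x : word d.+1 x = odd x :: word d x./2.
Proof.
rewrite /word /mkseq /= expn0 divn1 -[1]/(1 + 0) iotaDl -map_comp.
by congr cons; apply: eq_map => b /=; rewrite add1n expnS divnMA divn2.
Qed.

Lemma word_inj d x y : x < 2 ^ d -> y < 2 ^ d -> word d x = word d y -> x = y.
Proof.
elim: d x y => [|d IH] x y; first by rewrite expn0 !ltnS !leqn0 => /eqP-> /eqP->.
rewrite expnS !wordS => hx hy [oxy /IH hh]; rewrite -(odd_double_half x) oxy.
by rewrite hh ?odd_double_half //; lia.
Qed.

(** The [d] most significant of the [up_log 2 n] bits of [y], in the order of [encode], lowest
    first. *)
Definition block (n d y : nat) : bits := word d (y %/ 2 ^ (up_log 2 n - d)).

Lemma size_block n d y : size (block n d y) = d.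
Proof. exact: size_mkseq. Qed.

Lemma block_encode n (y : 'I_n) : block n (up_log 2 n) y = encode y.
Proof. by rewrite /block subnn expn0 divn1. Qed.

(** Once the leading bits of [F x] are fixed, its [up_log 2 n - d] low bits determine [F x], hence
    [x]. *)
Lemma card_block n d w (F : 'I_n -> 'I_n) : injective F -> d <= up_log 2 n ->
  #|[pred x | block n d (F x) == w]| <= 2 ^ (up_log 2 n - d).
Proof.
move=> Finj dL; set e := _ - d; have e0 : 0 < 2 ^ e by rewrite expn_gt0.
pose low x : 'I_(2 ^ e) := Ordinal (ltn_pmod (F x) e0).
rewrite -[leqRHS]card_ord; apply: (@leq_card_in _ _ low) => x y.
rewrite !inE => /eqP bx /eqP by_ /(congr1 val) /= mxy.
apply/Finj/val_inj; rewrite /= (divn_eq (F x) (2 ^ e)) mxy [RHS](divn_eq _ (2 ^ e)).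
congr (_ * _ + _); apply: (@word_inj d); last exact: etrans bx (esym by_).
all: rewrite ltn_divLR // -expnD /e subnKC //.
all: by apply: leq_trans (ltn_ord _) (up_logP _ _).
Qed.

Definition entries (n d d' : nat) (w : bits) (F : 'I_n -> 'I_n) :=
  [seq (if block n d (F x) == w then Some (block n d' (F x)) else None)
  | x <- enum 'I_n].

Lemma size_entries n d d' w (F : 'I_n -> 'I_n) : size (entries d d' w F) = n.
Proof. by rewrite size_map size_enum_ord. Qed.

Lemma entries_width n d d' w (F : 'I_n -> 'I_n) :
  all (entry_width d') (entries d d' w F).
Proof.
apply/allP => o /mapP[x _ ->]; case: eqP => //= _.
by rewrite size_block.
Qed.

Lemma nth_entries n d d' w (F : 'I_n -> 'I_n) (x : 'I_n) :
  block n d (F x) = w -> nth None (entries d d' w F) x = Some (block n d' (F x)).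
Proof.
by move=> Fx; rewrite (nth_map x) ?size_enum_ord // nth_ord_enum Fx eqxx.
Qed.

Lemma count_entries n d d' w (F : 'I_n -> 'I_n) :
  count isSome (entries d d' w F) = #|[pred x | block n d (F x) == w]|.
Proof.
rewrite count_map -sum1_count big_enum_cond -sum1_card.
by apply: eq_bigl => x /=; rewrite inE; case: eqP.
Qed.

(** * Rounded iterated logarithms *)

Lemma up_log_leq m : up_log 2 m <= m.
Proof. by apply: up_log_min => //; apply/ltnW/ltn_expl. Qed.

Lemma expn_up_log n : 0 < n -> 2 ^ up_log 2 n <= 2 * n.
Proof.
case: n => [|[|n]] // _.
have := up_log_gtn (isT : 1 < 2) (isT : 1 < n.+2); have : 0 < up_log 2 n.+2.
  by rewrite up_log_gt0.
by case: up_log => // l _ /=; rewrite expnS; lia.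
Qed.

(** The numbers d_j, with logarithms rounded up. The value at 0 is set apart: it is not the
    logarithm of d_1. *)
Definition precision (k n j : nat) : nat :=
  if j is 0 then 0 else iter (k - j) (up_log 2) n.

Lemma precision_last k n : 1 < k -> precision k n k.-1 = up_log 2 n.
Proof. by case: k => [|[|k]] //= _; rewrite subSn // subnn. Qed.

Lemma precision_pred k n j : 1 < j <= k ->
  precision k n j.-1 = up_log 2 (precision k n j).
Proof. by case: j => [|[|j]] //= jk; rewrite -iterS; congr iter; lia. Qed.

Lemma precision_le k n j : j < k -> precision k n j <= up_log 2 n.
Proof.
case: j => // j jk; rewrite /precision.
have -> : k - j.+1 = (k - j.+2).+1 by lia.
elim: (_ - _) => //= m IH; exact: leq_trans (up_log_leq _) IH.
Qed.

(** * The composition cut at a player *)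

Definition before (k n j : nat) (z : perm_input k n) : 'I_n :=
  foldl (fun x l => z.2 l x) z.1 (take j.-2 (enum 'I_k.-1)).

(** Index [l] stands for f_(l+2), so for j > 1 this is F_j, and [before j z] is x_(j-1). *)
Definition after (k n j : nat) (z : perm_input k n) (x : 'I_n) : 'I_n :=
  foldl (fun x l => z.2 l x) x (drop j.-1 (enum 'I_k.-1)).

Lemma after_before k n j (z : perm_input k n) :
  after j z (before j.+1 z) = mpj_perm z.
Proof. by rewrite /after /before -foldl_cat cat_take_drop. Qed.

Lemma after_inj k n j (z : perm_input k n) : injective (after j z).
Proof.
by rewrite /after; elim: (drop _ _) => //= l s IH x y /IH /perm_inj.
Qed.

Lemma eq_foldl_in (A : Type) (B : eqType) (f g : A -> B -> A) (s : seq B) a :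
  (forall x b, b \in s -> f x b = g x b) -> foldl f a s = foldl g a s.
Proof.
elim: s a => //= b s IH a fg; rewrite fg ?mem_head //; apply: IH => x c cs.
by apply: fg; rewrite inE cs orbT.
Qed.

Lemma mem_take_enum m a (l : 'I_m) : (l \in take a (enum 'I_m)) = (l < a).
Proof. by rewrite in_take ?mem_enum // index_enum_ord. Qed.

Lemma mem_drop_enum m a (l : 'I_m) : (l \in drop a (enum 'I_m)) = (a <= l).
Proof.
rewrite -(mem_map val_inj) map_drop val_enum_ord drop_iota mem_iota add0n.
by have := ltn_ord l; rewrite /=; lia.
Qed.

Lemma eq_before k n j (z z' : perm_input k n) : 1 < j ->
  agree_on (fun h => h < j) z z' -> before j z = before j z'.
Proof.
move=> j1 [/(_ j1) e1 e2]; rewrite /before e1; apply: eq_foldl_in => x l.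
by rewrite mem_take_enum => lj; rewrite e2 //; lia.
Qed.

(** Evaluating g_j at starting point [x] and identity permutations gives F_j x. *)
Lemma eq_after k n j (z z' : perm_input k n) : 0 < j ->
  (forall w : perm_input k n,
     mpj_perm (splice j w z) = mpj_perm (splice j w z')) ->
  after j z =1 after j z'.
Proof.
move=> j0 gj x; pose w : perm_input k n := (x, [ffun=> 1%g]).
have mpjE y : mpj_perm (splice j w y) = after j y x.
  rewrite -(after_before j) /before /= j0.
  rewrite (@eq_foldl_in _ _ _ (fun u _ => u)) => [|u l].
    have -> : foldl (fun u (_ : 'I_k.-1) => u) x (take j.-1 (enum 'I_k.-1)) = x.
      by elim: (take _ _).
    apply: eq_foldl_in => u l; rewrite mem_drop_enum ffunE => jl.
    by rewrite ifF //; lia.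
  by rewrite mem_take_enum !ffunE => lj; rewrite ifT ?perm1 //; lia.
by rewrite -!mpjE.
Qed.

(* The hint is the entry of [before j z] in the message of player [j - 1]; for
   [j = 1] it is empty, whatever the board, because [precision k n 0 = 0]. *)
Definition hint (k n j : nat) (z : perm_input k n) (t : seq bits) : bits :=
  lookup (precision k n j.-1) (before j z) (last [::] t).

Definition refine (k n j : nat) (z : perm_input k n) (t : seq bits) : bits :=
  if j < k then
    table (entries (precision k n j.-1) (precision k n j) (hint j z t)
                   (after j z))
  else hint j z t.

Lemma eq_entries n d d' w (F G : 'I_n -> 'I_n) :
  F =1 G -> entries d d' w F = entries d d' w G.
Proof. by move=> FG; apply: eq_map => x; rewrite FG. Qed.

Lemma refine_collapsing k n j (z z' : perm_input k n) (t : seq bits) :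
  0 < j -> agree_on (fun h => h < j) z z' ->
  (forall w : perm_input k n,
     mpj_perm (splice j w z) = mpj_perm (splice j w z')) ->
  refine j z t = refine j z' t.
Proof.
move=> j0 zz' gj; have eh : hint j z t = hint j z' t.
  rewrite /hint; case: j j0 zz' {gj} => [|[|j]] //= _ zz'; first by rewrite !lookup0.
  by rewrite (eq_before _ zz').
by rewrite /refine eh (eq_entries _ _ _ (eq_after j0 gj)).
Qed.

(** What a collapsing player uses is determined by the coordinates other than her own. *)
Lemma refine_nof k n j (z z' : perm_input k n) (t : seq bits) :
  1 <= j <= k -> agree_on (fun h => h != j) z z' ->
  refine j z t = refine j z' t.
Proof.
case/andP=> j0 jk [e1 e2]; apply: refine_collapsing => // [|w].
  by split=> [j1|l lj]; [apply: e1|apply: e2]; lia.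
congr mpj_perm; rewrite /splice j0; congr pair; apply/ffunP => l; rewrite !ffunE.
by case: leqP => // jl; apply: e2; lia.
Qed.

Definition refine_protocol (k n : nat) : nof_protocol k n :=
  NofProtocol (@refine_nof k n).

(** * Correctness and cost of the protocol *)

Lemma hint_correct k n (z : perm_input k n) j : 1 <= j <= k ->
  hint j z (board (refine_protocol k n) z j.-1) =
  block n (precision k n j.-1) (mpj_perm z).
Proof.
case: j => // j; elim: j => [|j IH] jk; first by rewrite /hint lookup0.
have jk' : j.+1 < k by lia.
(* The point [before j.+2 z] is sent to the answer by [after j.+1 z]. By induction its leading bits
   match the previous hint, so it is listed. *)
rewrite /hint /= last_rcons /refine jk' -(after_before j.+1).
apply: lookup_table (entries_width _ _ _ _) _; apply: nth_entries.
by rewrite after_before IH //; lia.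
Qed.

Lemma refine_correct k n : 1 < k -> computes_mpj_perm (refine_protocol k n).
Proof.
move=> k1 z; rewrite /sent /= /refine ltnn hint_correct ?precision_last //.
  exact: block_encode.
by lia.
Qed.

Lemma refine_self_delimiting k n :
  1 < k -> self_delimiting (refine_protocol k n).
Proof.
move=> k1 j z z' jk _; have [jk'|kj] := ltnP j k.
  rewrite /sent /= /refine jk'.
  by apply: table_prefix_free (entries_width _ _ _ _) (entries_width _ _ _ _) _;
    rewrite !size_entries.
have -> : j = k by lia.
rewrite !refine_correct // prefixE !size_mkseq => /eqP <-.
by rewrite take_oversize // size_mkseq.
Qed.

Lemma size_refine k n j (z : perm_input k n) : 1 < k -> 1 <= j <= k ->
  size (sent (refine_protocol k n) j z) <= 3 * n + n * precision k n 1.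
Proof.
move=> k1 jk; have n0 : 0 < n by apply: leq_trans (ltn_ord z.1).
have [jk'|kj] := ltnP j k; last first.
  have -> : j = k by lia.
  by rewrite refine_correct // size_mkseq; have := up_log_leq n; lia.
rewrite /sent /= /refine jk' (size_table (entries_width _ _ _ _)) size_entries.
rewrite count_entries; set A := [pred x | _].
(* Player 1 filters with 0 bits and may list all [n] points. *)
have [->|j1] := eqVneq j 1.
  have An : #|A| <= n by rewrite -[leqRHS]card_ord max_card.
  by rewrite leq_add ?leq_mul // leq_pmull.
have jk1 : 1 < j <= k by lia.
have dL : precision k n j.-1 <= up_log 2 n by apply: precision_le; lia.
have cA : #|A| <= _ := card_block _ (after_inj (z := z)) dL.
(* This cancels the bound on [#|A|]: the listed words take at most [2 ^ up_log 2 n <= 2 * n] bits,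
   and the flags take [n] more. *)
have pj : precision k n j <= 2 ^ precision k n j.-1.
  by rewrite precision_pred // up_logP.
have := leq_mul cA pj; rewrite -expnD subnK // => /leq_trans.
by move=> /(_ _ (expn_up_log n0)); lia.
Qed.

Lemma size_board k n (P : nof_protocol k n) (z : perm_input k n) j :
  \sum_(m <- board P z j) size m = \sum_(1 <= i < j.+1) size (sent P i z).
Proof.
elim: j => [|j IH]; first by rewrite big_nil big_geq.
by rewrite /= -cats1 big_cat big_seq1 big_nat_recr //= IH.
Qed.

Lemma cost_refine k n : 1 < k ->
  cost (refine_protocol k n) <= k * (n * (3 + precision k n 1)).
Proof.
move=> k1; apply/bigmax_leqP => z _; rewrite size_board.
rewrite big_nat (leq_trans (leq_sum _ (E2 := fun=> 3 * n + n * precision k n 1) _)) //.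
  by move=> j jk; apply: size_refine.
by rewrite -big_nat sum_nat_const_nat; lia.
Qed.

(** * Comparison with real iterated logarithms *)

Local Open Scope classical_set_scope.
Local Open Scope ring_scope.

Lemma ln2_gt0 (R : realType) : 0 < ln (2 : R).
Proof. by rewrite ln_gt0 // ltr1n. Qed.

Lemma ler_log2 (R : realType) (x y : R) : 0 < x -> x <= y -> log2 x <= log2 y.
Proof.
move=> x0 xy; rewrite /log2 ler_pM2r ?invr_gt0 ?ln2_gt0 // ler_ln // posrE //.
exact: lt_le_trans xy.
Qed.

Lemma log2_double (R : realType) (x : R) : 0 < x -> log2 (2 * x) = 1 + log2 x.
Proof.
by move=> x0; rewrite /log2 lnM ?posrE // mulrDl divff // gt_eqF // ln2_gt0.
Qed.

Lemma up_log_le_log2 (R : realType) (n : nat) :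
  (0 < n)%N -> (up_log 2 n)%:R <= 1 + log2 (n%:R : R).
Proof.
case: n => [|[|n]] // _; first by rewrite up_log1 /log2 ln1 mul0r addr0.
have := up_log_gtn (isT : (1 < 2)%N) (isT : (1 < n.+2)%N).
have := up_log_gt0 2 n.+2; case: up_log => // l _ /= h.
rewrite -natr1 addrC lerD2l.
have -> : l%:R = log2 (2 ^+ l : R).
  by rewrite /log2 lnXn // mulrnAl divff // gt_eqF // ln2_gt0.
by apply: ler_log2; rewrite ?exprn_gt0 // -natrX ler_nat ltnW.
Qed.

(** Ensures that for large [n] the iterates are positive, where [log2] is monotone. *)
Lemma iterated_log_dvg (R : realType) (m : nat) (A : R) :
  \forall n \near \oo, A <= iterated_log m (n%:R : R).
Proof.
elim: m A => [|m IH] A; first exact: nbhs_infty_ger.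
near=> n.
have h : expR (A * ln 2) <= iterated_log m (n%:R : R) by near: n; exact: IH.
rewrite /iterated_log iterS /log2 ler_pdivlMr ?ln2_gt0 //.
by rewrite -ler_expR lnK // posrE (lt_le_trans (expR_gt0 _) h).
Unshelve. all: by end_near. Qed.

(** Rounding errors do not accumulate: for x >= 2, 1 + log (x + 2) <= 1 + log (2 x) = log x + 2. *)
Lemma iter_up_log_le (R : realType) (m : nat) :
  \forall n \near \oo,
    (iter m (up_log 2) n)%:R <= iterated_log m (n%:R : R) + 2.
Proof.
elim: m => [|m IH]; first by near=> n; rewrite lerDl.
near=> n.
have h : (iter m (up_log 2) n)%:R <= iterated_log m (n%:R : R) + 2.
  by near: n; exact: IH.
have b2 : 2 <= iterated_log m (n%:R : R) by near: n; exact: iterated_log_dvg.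
have b3 : 0 <= iterated_log m.+1 (n%:R : R) by near: n; exact: iterated_log_dvg.
rewrite iterS; case: (posnP (iter m (up_log 2) n)) => [->|a0].
  by rewrite up_log0 addr_ge0.
have := @up_log_le_log2 R _ a0 => /le_trans; apply.
have -> : iterated_log m.+1 (n%:R : R) + 2 =
    1 + log2 (2 * iterated_log m (n%:R : R)).
  by rewrite log2_double ?(lt_le_trans _ b2) // /iterated_log iterS; ring.
by rewrite lerD2l ler_log2 ?ltr0n // (le_trans h) //; lra.
Unshelve. all: by end_near. Qed.

Theorem theorem1p5 (R : realType) (k : nat) (hk : (3 <= k)%N) :
  exists P : forall n : nat, nof_protocol k n,
    (forall n : nat,
       [/\ self_delimiting (P n),
           computes_mpj_perm (P n) &
           forall j : nat, (1 <= j <= k)%N -> collapsing (P n) j]) /\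
    (fun n : nat => (cost (P n))%:R : R^o)
      =O_\oo (fun n : nat => n%:R * iterated_log k.-1 n%:R : R^o).
Proof.
have k1 : (1 < k)%N by lia.
exists (refine_protocol k); split=> [n|].
  split; [exact: refine_self_delimiting|exact: refine_correct|].
  by move=> j /andP[j0 _] z z' t; exact: refine_collapsing.
(* Each of the [k] messages has at most n (3 + d_1) bits, and with L the iterated logarithm, 3 + d_1
   <= L + 5 <= 6 L once L >= 1. *)
apply/eqO_exP; exists (k%:R * 6); first by rewrite mulr_gt0 ?ltr0n //; lia.
near=> n.
have il1 : 1 <= iterated_log k.-1 (n%:R : R) by near: n; exact: iterated_log_dvg.
have d1 : (precision k n 1)%:R <= iterated_log k.-1 (n%:R : R) + 2.
  by rewrite /precision subn1; near: n; exact: iter_up_log_le.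
rewrite ger0_norm // ger0_norm ?mulr_ge0 ?(le_trans _ il1) //.
apply: le_trans (_ : (k * (n * (3 + precision k n 1)))%:R <= _).
  by rewrite ler_nat cost_refine.
rewrite !natrM natrD -mulrA ler_wpM2l // mulrCA ler_wpM2l //.
by lra.
Unshelve. all: by end_near. Qed.
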